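(* With $\beta=1/p^2$, the lattice $\varphi_\beta(M)\subset\mathbb{R}^n$ is a rotated version of $D_n$, i.e. $\varphi_\beta(M)=D_nQ$ for some real orthogonal $n\times n$ matrix $Q$.
   Context: Let $n>1$ be an odd integer and $p$ a prime with $p\equiv 1 \pmod n$. Let $\zeta_p=e^{2\pi i/p}$, let $r$ be a primitive root modulo $p$, and let $\sigma$ be the automorphism of $\mathbb{Q}(\zeta_p)$ with $\sigma(\zeta_p)=\zeta_p^r$. Let $\mathbb{K}=\{y\in\mathbb{Q}(\zeta_p):\sigma^n(y)=y\}$ (totally real of degree $n$, embeddings into $\mathbb{R}$ given by the restrictions of $\sigma^0,\dots,\sigma^{n-1}$). Let $\alpha=\prod_{j=0}^{(p-3)/2}(1-\zeta_p^{r^j})$, let $\lambda$ be an integer with $\lambda(r-1)\equiv1\pmod p$, $z=\zeta_p^{\lambda}\alpha(1-\zeta_p)$, and $x=\mathrm{Tr}_{\mathbb{Q}(\zeta_p)/\mathbb{K}}(z)=\sum_{j=1}^{(p-1)/n}\sigma^{jn}(z)$. For a totally positive $\beta\in\mathbb{K}$ define $\varphi_\beta:\mathbb{K}\to\mathbb{R}^n$, $\varphi_\beta(y)=(\sqrt{\sigma^0(\beta)}\sigma^0(y),\dots,\sqrt{\sigma^{n-1}(\beta)}\sigma^{n-1}(y))$. Let $M$ be the $\mathbb{Z}$-module generated by $x+\sigma(x),\ x-\sigma(x),\ \sigma(x)-\sigma^2(x),\dots,\sigma^{n-2}(x)-\sigma^{n-1}(x)$. $D_n=\{(y_1,\dots,y_n)\in\mathbb{Z}^n: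 y_1+\dots+y_n \text{ even}\}$. *)

(* Defs.v *)
From HB Require Import structures.
From mathcomp Require Import all_boot all_order all_algebra all_field.
Set Implicit Arguments. Unset Strict Implicit. Unset Printing Implicit Defensive.
Import Order.TTheory GRing.Theory Num.Theory.
Local Open Scope ring_scope.

(* z is zeta_p = e^{2 pi i / p}: the primitive p-th root of unity with positive
   imaginary part and maximal real part among the p-th roots of unity other than 1. *)
Definition is_zeta_p (p : nat) (z : algC) : Prop :=
  p.-primitive_root z /\ 0 < 'Im z /\
  (forall w : algC, w ^+ p = 1 -> w != 1 -> 'Re w <= 'Re z).

Definition prim_root_mod (p r : nat) : Prop :=
  (p.-1).-primitive_root (r%:R : 'F_p).

Definition alpha (p r : nat) (z : algC) : algC :=
  \prod_(j < p.-1./2) (1 - z ^+ (r ^ j)).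

Definition zz (p r : nat) (lam : int) (z : algC) : algC :=
  z ^ lam * alpha p r z * (1 - z).

(* x = Tr_{Q(zeta)/K}(zz) = sum_{j=1}^{(p-1)/n} sigma^{jn}(zz) *)
Definition xx (n p r : nat) (lam : int) (s : algC -> algC) (z : algC) : algC :=
  \sum_(1 <= j < ((p.-1) %/ n).+1) iter (j * n) s (zz p r lam z).

Definition genM (s : algC -> algC) (x : algC) (k : nat) : algC :=
  if k == 0%N then x + s x else iter k.-1 s x - iter k s x.

Definition inM (n : nat) (s : algC -> algC) (x y : algC) : Prop :=
  exists c : 'I_n -> int, y = \sum_(i < n) genM s x i *~ c i.

Definition phi (n : nat) (s : algC -> algC) (beta y : algC) : 'rV[algC]_n :=
  \row_(k < n) (sqrtC (iter k s beta) * iter k s y).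

Definition inDn (n : nat) (d : 'rV[int]_n) : Prop :=
  (2 %| \sum_(i < n) d 0 i)%Z.

(* Main.v *)
Require Import Defs.
From HB Require Import structures.
From mathcomp Require Import all_boot all_order all_algebra all_field.
From mathcomp Require Import zify.
Import Order.TTheory GRing.Theory Num.Theory.
Local Open Scope ring_scope.

(* Put g = zeta^lambda * alpha.  Telescoping alpha and using lambda (r - 1) = 1
   mod p gives sigma(g) = - g, and g sigma^((p-1)/2)(g) is the product of all
   1 - zeta^a, i.e. p; hence g^2 = (-1)^((p-1)/2) p.  Since n is odd and (p-1)/n is
   even, the terms free of zeta^a cancel in the trace, so that sigma^k(x) is - g
   times the sum of (-1)^a zeta^(r^a) over a = k mod n.  Expanding the products
   and summing over the orbit of zeta shows that the matrix with entries
   sigma^(l+k)(x) / p is orthogonal; it carries e_1 + e_2, e_1 - e_2, ...,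
   e_(n-1) - e_n, a basis of D_n, to the images of the generators of M. *)

(** * Finite sums: periodic shifts, alternating signs, blocks *)

Lemma sum_shift_periodic (V : zmodType) (L : nat) (f : nat -> V) (u : nat) :
  (forall v, f (v + L)%N = f v) ->
  \sum_(v < L) f (v + u)%N = \sum_(v < L) f v.
Proof.
move=> fL; elim: u => [|u IHu]; first by apply: eq_bigr => v _; rewrite addn0.
rewrite -IHu; apply: (addrI (f u)).
have: \sum_(v < L.+1) f (v + u)%N = f u + \sum_(v < L) f (v + u)%N.
  by rewrite big_ord_recr /= addnC fL addrC.
by rewrite big_ord_recl => <-; congr (_ + _); apply: eq_bigr => v _; rewrite addSnnS.
Qed.

Lemma sum_sign_even (R : pzRingType) (N : nat) :
  ~~ odd N -> \sum_(v < N) (-1) ^+ v = 0 :> R.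
Proof.
move=> Nev; rewrite -[N]even_halfK //; elim: N./2 => [|k IHk]; first by rewrite big_ord0.
by rewrite doubleS !big_ord_recr /= IHk add0r exprS mulN1r subrr.
Qed.

Lemma sum_nat_mul (V : nmodType) (k l : nat) (f : nat -> V) :
  \sum_(u < k) \sum_(v < l) f (u * l + v)%N = \sum_(a < k * l) f a.
Proof.
rewrite -(big_mkord predT f) big_nat_mul big_mkord; apply: eq_bigr => u _.
rewrite -[X in index_iota X]add0n big_addn mulSn addnK big_mkord.
by apply: eq_bigr => v _; rewrite addnC.
Qed.

(** * Integer combinations of the generators of D_n *)

(* genM s x, with the iterates of s on x replaced by an arbitrary sequence w. *)
Definition Dn_gen {V : zmodType} (w : nat -> V) (k : nat) : V :=
  if k == 0%N then w 0%N + w 1%N else w k.-1 - w k.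

(** Row [b i] holds the coordinates of generator [i]; its coordinate sum is read off at the constant
    sequence 1, which gives 2 or 0. *)
Lemma Dn_gen_comb_inDn (n : nat) (c : 'I_n -> int) : (1 < n)%N ->
  exists2 d : 'rV[int]_n, inDn d & forall (V : zmodType) (w : nat -> V),
    \sum_(i < n) Dn_gen w i *~ c i = \sum_(l < n) w l *~ d 0 l.
Proof.
move=> n_gt1; pose b (i : nat) : 'rV[int]_n := \row_l Dn_gen (fun t => (t == l)%:R) i.
have delta (V : zmodType) (w : nat -> V) t :
    (t < n)%N -> \sum_(l < n) w l *~ (t == l :> nat)%:R = w t.
  move=> tn; rewrite (bigD1 (Ordinal tn)) //= eqxx mulr1z big1 ?addr0 // => l.
  by rewrite eq_sym -[t]/(val (Ordinal tn)) (inj_eq val_inj) => /negPf ->.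
have bE (V : zmodType) (w : nat -> V) i :
    (i < n)%N -> \sum_(l < n) w l *~ b i 0 l = Dn_gen w i.
  move=> lt_in; under eq_bigr do rewrite mxE.
  rewrite /Dn_gen; case: eqP => i0.
    under eq_bigr do rewrite mulrzDr.
    by rewrite big_split !delta // ltnW.
  under eq_bigr do rewrite mulrzBr.
  by rewrite sumrB !delta //; lia.
exists (\sum_i c i *: b i) => [|V w].
  rewrite /inDn; under eq_bigr do rewrite summxE.
  rewrite exchange_big rpred_sum //= => i _.
  under eq_bigr do rewrite mxE.
  rewrite -mulr_sumr dvdz_mull //.
  have -> : \sum_(l < n) b i 0 l = Dn_gen (fun=> 1) i.
    by rewrite -bE //; apply: eq_bigr => l _; rewrite intz.
  by rewrite /Dn_gen; case: eqP.
under [RHS]eq_bigr do rewrite summxE mulrz_sumr.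
rewrite exchange_big /=; apply: eq_bigr => i _.
rewrite -bE // mulrz_suml; apply: eq_bigr => l _.
by rewrite [in RHS]mxE mulrC mulrzA.
Qed.

(* Abel summation on the tail sums T of d, where T 0 is even by assumption. *)
Lemma inDn_Dn_gen_comb (n : nat) (d : 'rV[int]_n) : (1 < n)%N -> inDn d ->
  exists c : 'I_n -> int, forall (V : zmodType) (w : nat -> V),
    \sum_(l < n) w l *~ d 0 l = \sum_(i < n) Dn_gen w i *~ c i.
Proof.
case: n d => [|[|n]] // d _ /dvdzP[h hE].
pose T k : int := \sum_(l < n.+2 | (k <= l)%N) d 0 l.
(* As [T 0] is [h * 2], the term in [w 0] is [h] times (w 0 + w 1) + (w 0 - w 1): this puts [h] at
   index 0 and an extra [h] at index 1. *)
pose c k : int := if k is k'.+1 then (if k' is 0%N then h else 0) - T k else h.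
exists c => V w.
have T0 : T 0%N = h * 2 by rewrite -hE.
have Tend : T n.+2 = 0 by rewrite /T big1 // => l; rewrite leqNgt ltn_ord.
have dE (l : 'I_n.+2) : d 0 l = T l - T l.+1.
  rewrite /T (bigD1 l) //=.
  under eq_bigl => j do rewrite andbC eq_sym -ltn_neqAle.
  by rewrite addrK.
under eq_bigr do rewrite dE mulrzBr.
rewrite sumrB big_ord_recl [X in _ - X]big_ord_recr /= Tend mulr0z addr0.
rewrite [RHS]big_ord_recl /= T0 -addrA -sumrB.
under [X in _ = _ + X]eq_bigr do rewrite mulrzBr.
rewrite [X in _ = _ + X]sumrB [RHS]addrA -[X in _ = _ + X]sumrN; congr (_ + _); last first.
  by apply: eq_bigr => i _; rewrite -mulrzBl -mulNrz opprB.
rewrite big_ord_recl /= big1 ?addr0; last by move=> i _; rewrite mulr0z.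
by rewrite /Dn_gen /= -mulrzDl addrACA subrr addr0 mulrC mulrzA.
Qed.

(** * Iterates of a ring endomorphism as ring morphisms *)

Section IterMorphism.
Variables (R : pzRingType) (f : {rmorphism R -> R}) (k : nat).

Fact iter_is_zmod_morphism : zmod_morphism (iter k f).
Proof. by elim: k => // j IHj x y; rewrite !iterS IHj rmorphB. Qed.

Fact iter_is_monoid_morphism : monoid_morphism (iter k f).
Proof.
by elim: k => // j [IH1 IHM]; split=> [|x y]; rewrite !iterS ?IH1 ?IHM ?rmorph1 ?rmorphM.
Qed.

HB.instance Definition _ := GRing.isZmodMorphism.Build R R (iter k f) iter_is_zmod_morphism.
HB.instance Definition _ := GRing.isMonoidMorphism.Build R R (iter k f) iter_is_monoid_morphism.

End IterMorphism.

(** * Roots of unity indexed by powers of a primitive root *)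

Section RootsOfUnity.
Variables (p r : nat) (z : algC).
Hypotheses (p_pr : prime p) (zP : p.-primitive_root z) (rP : prim_root_mod p r).

Let E (w : 'F_p) : algC := z ^+ w.

Lemma expr_FpE k : E k%:R = z ^+ k.
Proof. by rewrite /E val_Fp_nat // (prim_expr_mod zP). Qed.

Lemma big_units_Fp (R : Type) (idx : R) (op : Monoid.com_law idx) (F : 'F_p -> R) :
  \big[op/idx]_(a < p.-1) F (r%:R ^+ a) = \big[op/idx]_(w | w != 0) F w.
Proof.
rewrite -(big_map (fun a : 'I_p.-1 => r%:R ^+ a) predT F) big_uniq /=.
  apply: eq_bigl => w; apply/mapP/idP => [[a _ ->]|w0].
    by rewrite expf_neq0 // (prim_root_eq0 rP); case: (p.-1) a => [[]|].
  have [|a wa] := prim_rootP rP (_ : w ^+ p.-1 = 1).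
    apply: (mulfI w0); rewrite -exprS prednK ?prime_gt0 // mulr1.
    by have := expf_card w; rewrite card_Fp.
  by exists a; rewrite // mem_index_enum.
rewrite map_inj_uniq ?index_enum_uniq // => a b /eqP.
by rewrite (eq_prim_root_expr rP) !modn_small // => /eqP /val_inj.
Qed.

(** Cancel X - 1 in the factorisation of X^p - 1, then evaluate at X = 1. *)
Lemma prod_one_sub_prim_root : \prod_(a < p.-1) (1 - z ^+ (r ^ a)) = p%:R.
Proof.
transitivity (\prod_(w : 'F_p | w != 0) (1 - E w)).
  by rewrite -big_units_Fp; apply: eq_bigr => a _; rewrite -natrX expr_FpE.
have := factor_Xn_sub_1 zP; rewrite -[X in index_iota 0 X](Fp_cast p_pr) big_mkord.
rewrite (bigD1 (0 : 'F_p)) //= subrX1 => /(mulfI _).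
rewrite polyXsubC_eq0 => /(_ isT) /(congr1 (horner^~ 1)).
rewrite horner_prod horner_sum.
under eq_bigr do rewrite !hornerE.
move=> ->; under eq_bigr do rewrite !hornerE expr1n.
by rewrite sumr_const card_ord.
Qed.

(** With the term w = 0 added this is a full character sum. If p does not divide [c], the shift w ->
    1 + w multiplies it by z^c, which is not 1, so it vanishes. *)
Lemma sum_prim_root_orbit c :
  \sum_(a < p.-1) z ^+ (r ^ a * c) = p%:R *+ (p %| c)%N - 1.
Proof.
transitivity (\sum_(w : 'F_p | w != 0) E (w * c%:R)).
  by rewrite -big_units_Fp; apply: eq_bigr => a _; rewrite -natrX -natrM expr_FpE.
have -> : \sum_(w : 'F_p | w != 0) E (w * c%:R) = \sum_w E (w * c%:R) - 1.
  by rewrite [in RHS](bigD1 0) //= mul0r {2}/E expr0 [1 + _]addrC addrK.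
congr (_ - 1); have ED u v : E (u + v) = E u * E v.
  by rewrite -(natr_Zp u) -(natr_Zp v) -natrD !expr_FpE exprD.
have [pc|pNc] := boolP (p %| c)%N.
  have -> : c%:R = 0 :> 'F_p by apply/eqP; rewrite -(dvdn_pcharf (pchar_Fp p_pr)).
  under eq_bigr do rewrite mulr0 /E expr0.
  by rewrite sumr_const card_Fp.
rewrite mulr0n; apply/eqP.
have: z ^+ c - 1 != 0 by rewrite subr_eq0 -(prim_order_dvd zP).
move/mulfI/inj_eq <-; rewrite mulr0 mulrBl mul1r subr_eq0 mulr_sumr.
rewrite [eqbRHS](reindex_inj (addrI 1)) /=.
by apply/eqP/eq_bigr => w _; rewrite mulrDl mul1r ED expr_FpE.
Qed.

Hypothesis p_gt2 : (2 < p)%N.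
Let m := p.-1./2.

Let m2 : p.-1 = (m + m)%N.
Proof.
rewrite addnn /m even_halfK // -subn1 oddB ?prime_gt0 //.
by case: (even_prime p_pr) p_gt2 => [->|->].
Qed.

(** Modulo p, r^m squares to 1 but is not 1, since 0 < m < p - 1; hence it is -1. *)
Lemma expr_order_dvd_half : (p %| (r ^ m).+1)%N.
Proof.
rewrite (dvdn_pcharf (pchar_Fp p_pr)) -[(r ^ m).+1]addn1 natrD natrX.
have : (r%:R ^+ m) ^+ 2 == 1 :> 'F_p.
  by rewrite -exprM muln2 -addnn -m2 prim_expr_order.
rewrite sqrf_eq1 addr_eq0 => /orP[|//].
rewrite -(prim_order_dvd rP) => /dvdn_leq; rewrite m2.
by move: p_gt2 m2; case: (m) => [|k]; lia.
Qed.

Lemma dvdn_expD_half i j : (p %| r ^ i + r ^ j)%N = (i == j + m %[mod p.-1])%N.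
Proof.
rewrite -(eq_prim_root_expr rP) (dvdn_pcharf (pchar_Fp p_pr)) natrD !natrX.
have /eqP : (r ^ m).+1%:R == 0 :> 'F_p.
  by rewrite -(dvdn_pcharf (pchar_Fp p_pr)) expr_order_dvd_half.
rewrite -[(r ^ m).+1]addn1 natrD natrX => /eqP; rewrite addr_eq0 => /eqP rm.
by rewrite exprD rm mulrN1 addr_eq0.
Qed.

Let z0 : z != 0. Proof. by rewrite (prim_root_eq0 zP); case: (p) p_gt2. Qed.

Lemma eq_prim_exprz (a b : int) : (p %| a - b)%Z -> z ^ a = z ^ b.
Proof.
case/dvdzP => q abE; rewrite -[a](subrK b) abE expfzDr // mulrC.
by rewrite [q * p]mulrC -exprz_exp -exprnP (prim_expr_order zP) exp1rz mulr1.
Qed.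

Lemma expr_rD_half a : z ^+ (r ^ (a + m)) = (z ^+ (r ^ a))^-1.
Proof.
have nz : z ^+ (r ^ a) != 0 by rewrite expf_neq0 // (prim_root_eq0 zP); case: (p) p_gt2.
apply: (mulfI nz); rewrite mulfV // -exprD; apply/eqP.
rewrite -(prim_order_dvd zP) expnD -{1}[(r ^ a)%N]muln1 -mulnDr dvdn_mull //.
by rewrite add1n expr_order_dvd_half.
Qed.

Lemma expr_r_half : z ^+ (r ^ m) = z^-1.
Proof. by rewrite -(add0n m) expr_rD_half expn0 expr1. Qed.

Lemma expr_r_periodic a : z ^+ (r ^ (a + p.-1)) = z ^+ (r ^ a).
Proof. by rewrite m2 addnA !expr_rD_half invrK. Qed.

(** * The element g and its conjugates *)

Variable lam : int.
Hypothesis lamP : (lam * (r%:Z - 1) == 1 %[mod p])%Z.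

(** At [z] this is the quadratic Gauss sum up to sign, as [sqr_gauss] shows. The argument is kept
    free so that morphisms act by moving it. *)
Definition gauss (w : algC) : algC := w ^ lam * alpha p r w.
Let g := gauss z.

Lemma rmorph_gauss (f : {rmorphism algC -> algC}) w : f (gauss w) = gauss (f w).
Proof.
rewrite rmorphM fmorphXz /alpha rmorph_prod; congr (_ * _).
by apply: eq_bigr => j _; rewrite rmorphB rmorph1 rmorphXn.
Qed.

Lemma rmorph_zz (f : {rmorphism algC -> algC}) w : f (zz p r lam w) = zz p r lam (f w).
Proof. by rewrite /zz -!/(gauss _) rmorphM rmorph_gauss rmorphB rmorph1. Qed.

Variable s : {rmorphism algC -> algC}.
Hypothesis sz : s z = z ^+ r.

Lemma iter_z k : iter k s z = z ^+ (r ^ k).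
Proof. by elim: k => [|k IHk] //=; rewrite IHk rmorphXn sz -exprM expnS. Qed.

Let z1 : 1 - z != 0.
Proof.
rewrite subr_eq0 eq_sym -[z]expr1 -(prim_order_dvd zP) dvdn1.
by case: eqP p_gt2 => // ->.
Qed.

(** Under [s] the factors of [alpha] shift by one: 1 - z is lost and 1 - z^-1 = -z^-1 (1 - z) is
    gained. The power of z absorbs z^-1, as r lam - 1 = lam mod p. *)
Lemma s_gauss : s g = - g.
Proof.
have sal : s (alpha p r z) = - z^-1 * alpha p r z.
  apply: (mulfI z1); rewrite /alpha rmorph_prod -/m.
  under eq_bigr do rewrite rmorphB rmorph1 rmorphXn sz -exprM -expnS.
  have : \prod_(j < m.+1) (1 - z ^+ (r ^ j)) = (1 - z) * \prod_(j < m) (1 - z ^+ (r ^ j.+1)).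
    by rewrite big_ord_recl.
  move=> <-; rewrite big_ord_recr /=.
  rewrite expr_r_half mulrC mulrA.
  by congr (_ * _); rewrite mulrBl mul1r mulrN mulfV // opprK addrC.
rewrite /g /gauss rmorphM fmorphXz sz sal exprnP exprz_exp mulrA mulrN mulNr.
congr (- (_ * _)); rewrite -exprN1 -expfzDr //; apply: eq_prim_exprz.
have -> : r%:Z * lam + -1 - lam = lam * (r%:Z - 1) - 1 by rewrite mulrBr mulr1 mulrC addrAC.
by rewrite -eqz_mod_dvd.
Qed.

Lemma iter_s_gauss k : iter k s g = (-1) ^+ k * g.
Proof.
elim: k => [|k IHk] /=; first by rewrite mul1r.
by rewrite IHk rmorphM rmorph_sign s_gauss exprS mulrN !mulNr mul1r.
Qed.

Lemma sqr_gauss : g ^+ 2 = (-1) ^+ m * p%:R.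
Proof.
(* Since s^m inverts z, the powers z^lam cancel and the factors 1 - z^-(r^j) form the second half of
   the full product. *)
have -> : p%:R = g * iter m s g.
  rewrite rmorph_gauss /= iter_z expr_r_half.
  rewrite {1}/g /gauss mulrACA.
  rewrite -expfzMl mulfV // exp1rz mul1r -prod_one_sub_prim_root m2 big_split_ord /=.
  congr (_ * _); apply: eq_bigr => j _.
  by rewrite addnC expr_rD_half exprVn.
by rewrite iter_s_gauss mulrCA signrMK expr2.
Qed.

Let e a : algC := (-1) ^+ a * z ^+ (r ^ a).

Lemma zz_iter a : zz p r lam (z ^+ (r ^ a)) = g * ((-1) ^+ a - e a).
Proof.
rewrite -iter_z -(rmorph_zz (iter a s)) /zz -/(gauss z).
rewrite rmorphM /= iter_s_gauss rmorphB rmorph1 /= iter_z /e.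
by rewrite [_ * g]mulrC -mulrA mulrBr mulr1.
Qed.

Lemma e_periodic a : e (a + p.-1)%N = e a.
Proof. by rewrite /e expr_r_periodic exprD m2 addnn -muln2 exprM sqrr_sign mulr1. Qed.

(** * The trace x, its conjugates and their inner products *)

Variable n : nat.
Hypotheses (n_odd : odd n) (n_dvd : (n %| p.-1)%N).
Let N := (p.-1 %/ n)%N.

Let nN : (N * n)%N = p.-1. Proof. exact: divnK. Qed.

Let N_even : ~~ odd N.
Proof. by have := congr1 odd nN; rewrite oddM n_odd andbT m2 addnn odd_double => ->. Qed.

(** Complex conjugation, which acts as s^m on powers of z, is thus a power of s^n. *)
Let Nhalf : (N./2 * n)%N = m.
Proof.
apply: double_inj; rewrite -[in RHS]addnn -m2 -nN.
by rewrite -[in RHS](even_halfK N_even) -!muln2 mulnAC.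
Qed.

Let sign_n a b : (-1) ^+ (a * n + b) = (-1) ^+ (a + b) :> algC.
Proof. by rewrite -signr_odd oddD oddM n_odd andbT -oddD signr_odd. Qed.

Let x := xx n p r lam s z.

Lemma sum_step_shift (f : nat -> algC) u k : (forall a, f (a + p.-1)%N = f a) ->
  \sum_(v < N) f ((v + u) * n + k)%N = \sum_(v < N) f (v * n + k)%N.
Proof.
move=> fP; apply: (@sum_shift_periodic _ _ (fun v => f (v * n + k)%N)) => v.
by rewrite mulnDl nN addnAC fP.
Qed.

Lemma iter_xx k :
  iter k s x = \sum_(j < N) zz p r lam (z ^+ (r ^ (j * n + k))).
Proof.
rewrite /x /xx rmorph_sum big_add1 big_mkord /=.
(* The trace runs over j = 1..N; periodicity moves it to 0..N-1. *)
rewrite -(sum_step_shift (fun a => zz p r lam (z ^+ (r ^ a))) 1) => [|a].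
  apply: eq_bigr => j _; rewrite -iterD (rmorph_zz (iter _ s)) /= iter_z.
  by rewrite addn1 addnC.
by rewrite expr_r_periodic.
Qed.

Lemma iter_xxE k : iter k s x = - g * \sum_(j < N) e (j * n + k).
Proof.
rewrite iter_xx; under eq_bigr do rewrite zz_iter sign_n exprD.
rewrite -mulr_sumr big_split /= -mulr_suml sum_sign_even // mul0r add0r.
by rewrite sumrN mulrN mulNr.
Qed.

(** Conjugation inverts z, hence shifts the index of r by m = (N/2) n, which only permutes the terms
    of the trace. *)
Lemma iter_xx_real k : iter k s x \is Num.real.
Proof.
apply/CrealP; rewrite iter_xx rmorph_sum /=.
rewrite -(sum_step_shift (fun a => zz p r lam (z ^+ (r ^ a))) N./2) => [|a].
  apply: eq_bigr => j _; rewrite (rmorph_zz Num.conj) rmorphXn /=.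
  rewrite mulnDl Nhalf addnAC expr_rD_half; congr (zz _ _ _ _).
  rewrite -exprVn; congr (_ ^+ _).
  have nz : `|z| = 1.
    apply: (@pexpIrn _ p); rewrite ?nnegrE ?prime_gt0 //.
    by rewrite -normrX (prim_expr_order zP) normr1 expr1n.
  by rewrite invC_norm nz expr1n invr1 mul1r.
by rewrite expr_r_periodic.
Qed.

(** The left side is the trace from K to the rationals of s^i(x) s^j(x); up to the factor p^2 this
    is the orthogonality of the rotation matrix. *)
Lemma trace_form_xx (i j : 'I_n) :
  \sum_(k < n) iter (i + k) s x * iter (j + k) s x = p%:R ^+ 2 *+ (i == j).
Proof.
pose c v := (r ^ i + r ^ (v * n + j))%N.
(* Here [v] is the offset between the two summation indices. The sign is free of [u] and [k], so u n
   + k can sweep a whole orbit. *)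
have eM u v k : e (u * n + (i + k)) * e ((v + u) * n + (j + k))
    = (-1) ^+ (i + j + v) * z ^+ (r ^ (u * n + k) * c v).
  rewrite /e mulrACA -!exprD; congr (_ * z ^+ _); last first.
    rewrite /c mulnDr -!expnD; congr (r ^ _ + r ^ _)%N; lia.
  rewrite -[LHS]signr_odd -[RHS]signr_odd !oddD !oddM !oddD n_odd !andbT.
  by case: (odd i) (odd j) (odd k) (odd u) (odd v) => [] [] [] [] [].
transitivity (g ^+ 2 * \sum_(v < N) (-1) ^+ (i + j + v) *
     \sum_(u < N) \sum_(k < n) z ^+ (r ^ (u * n + k) * c v)).
  rewrite mulr_sumr.
  under [RHS]eq_bigr do (rewrite mulr_sumr mulr_sumr; under eq_bigr do rewrite !mulr_sumr).
  rewrite exchange_big /=; under [RHS]eq_bigr do rewrite exchange_big /=.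
  rewrite exchange_big /=; apply: eq_bigr => k _.
  rewrite !iter_xxE mulrACA mulrNN -expr2 mulr_suml mulr_sumr.
  apply: eq_bigr => u _; rewrite -(sum_step_shift e u _ e_periodic).
  by rewrite !mulr_sumr; apply: eq_bigr => v _; rewrite eM.
have /andP[N_gt0 n_gt0] : (0 < N)%N && (0 < n)%N.
  by rewrite -muln_gt0 nN -subn1 subn_gt0 ltnW.
have N2 : (N./2 + N./2)%N = N by rewrite addnn even_halfK.
(* The divisibility p | c v means i = (v + N/2) n + j mod N n. Modulo n this forces i = j, and then
   v = N/2 because v < N. *)
have orbit (v : 'I_N) : \sum_(u < N) \sum_(k < n) z ^+ (r ^ (u * n + k) * c v)
    = p%:R *+ ((i == j) && (v == N./2 :> nat)) - 1.
  rewrite (sum_nat_mul _ N n (fun a => z ^+ (r ^ a * c v))) nN.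
  rewrite sum_prim_root_orbit dvdn_expD_half -nN -Nhalf addnAC -mulnDl.
  congr (p%:R *+ nat_of_bool _ - 1); have [<-|ij] := altP (i =P j).
    rewrite -[X in X == _ %[mod _]]add0n eqn_modDr mod0n eq_sym.
    rewrite -/(dvdn _ _) dvdn_pmul2r //.
    apply/dvdnP/eqP => [[q]|->]; last by exists 1; rewrite mul1n.
    by move: (ltn_ord v) N_gt0 N2; case: q => [|[|q]]; rewrite ?mulSn; lia.
  apply: contraNF ij => /eqP /(congr1 (modn^~ n)).
  by rewrite !modn_dvdm ?dvdn_mull // modnMDl !modn_small // => /val_inj ->.
(* The -1 of each orbit sum disappears by alternation over the even range N. *)
under eq_bigr do rewrite orbit mulrBr mulr1.
rewrite sumrB; under [X in _ - X]eq_bigr do rewrite exprD.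
rewrite -mulr_sumr sum_sign_even // mulr0 subr0.
have [<-|_] := altP (i =P j); last by rewrite big1 ?mulr0 // => v _; rewrite mulr0.
have Nh : (N./2 < N)%N by lia.
rewrite (bigD1 (Ordinal Nh)) //= eqxx big1 ?addr0 => [|v vN]; last first.
  by rewrite -[_ == _ :> nat]/(v == Ordinal Nh) (negPf vN) mulr0.
(* The sign left is (-1)^(N/2); it cancels that of g^2, since m = (N/2) n has the parity of N/2. *)
rewrite addnn -signr_odd oddD odd_double signr_odd sqr_gauss.
by rewrite -Nhalf -[(_ * n)%N]addn0 sign_n addn0 mulrACA -expr2 sqrr_sign mul1r -expr2.
Qed.

End RootsOfUnity.

(** * The rotation matrix and the two inclusions *)

Theorem theorem2 (n p r : nat) (lam : int) (z : algC) (s : {rmorphism algC -> algC}) :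
  (1 < n)%N -> odd n -> prime p -> (n %| p.-1)%N ->
  is_zeta_p p z -> prim_root_mod p r ->
  (lam * (r%:Z - 1) == 1 %[mod p])%Z ->
  s z = z ^+ r ->
  let x := xx n p r lam s z in
  let beta : algC := (p%:R ^+ 2)^-1 in
  exists Q : 'M[algC]_n,
    (forall i j, Q i j \is Num.real) /\ Q *m Q^T = 1%:M /\
    (forall v : 'rV[algC]_n,
       (exists y, inM n s x y /\ v = phi n s beta y) <->
       (exists d : 'rV[int]_n, inDn d /\ v = map_mx intr d *m Q)).
Proof.
move=> n_gt1 n_odd p_pr n_dvd [zP _] rP lamP sz x beta.
have p_gt2 : (2 < p)%N.
  rewrite ltn_neqAle prime_gt1 // andbT; apply: contraTneq n_dvd => <-.
  by rewrite dvdn1; case: eqP n_gt1 => // ->.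
pose Q : 'M[algC]_n := \matrix_(l, k) (p%:R^-1 * iter (l + k) s x).
have p0 : p%:R != 0 :> algC by rewrite pnatr_eq0 -lt0n prime_gt0.
have Q_real i j : Q i j \is Num.real.
  rewrite mxE rpredM ?rpredV ?realn //; exact: iter_xx_real.
have phiE (d : 'rV[int]_n) :
    phi n s beta (\sum_(l < n) iter l s x *~ d 0 l) = map_mx intr d *m Q.
  apply/rowP => k; rewrite !mxE rmorph_sum mulr_sumr /=.
  (* As [beta] is rational, every iterate of [s] fixes it, and its nonnegative root is 1/p. *)
  have -> : sqrtC (iter k s beta) = p%:R^-1.
    by rewrite fmorphV rmorphXn rmorph_nat -exprVn sqrCK // invr_ge0 ler0n.
  apply: eq_bigr => l _; rewrite !mxE rmorphMz /= -iterD addnC.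
  by rewrite -mulrzl mulrCA mulrzl.
exists Q; split=> //; split.
  apply/matrixP => i j; rewrite !mxE.
  under eq_bigr do rewrite !mxE mulrACA.
  rewrite -mulr_sumr trace_form_xx // -expr2 mulrnAr exprVn mulVf //.
  by rewrite expf_neq0.
move=> v; split=> [[y [[c ->] ->]]|[d [dD ->]]].
  (* [genM s x] unfolds to [Dn_gen] of the iterates of [s] on [x], so combinations of generators
     become coordinates [d], to which [phiE] applies. *)
  have [d dD cE] := Dn_gen_comb_inDn _ c n_gt1.
  by exists d; split; rewrite // -phiE -cE.
have [c cE] := inDn_Dn_gen_comb _ d n_gt1 dD.
exists (\sum_(l < n) iter l s x *~ d 0 l); split; last by rewrite phiE.
by exists c; rewrite cE.
Qed.
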